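(* Let $Q$ be a left quasigroup with the LT property. If $$1=H_0\leq H_1\leq H_2\leq \ldots \leq H_n=\mathrm{Dis}(Q)$$ is an abelian (resp. central) series of $\mathrm{Dis}(Q)$ and $H_i\in \mathrm{Norm}(Q)$ for every $i\in \{1,\ldots,n-1\}$, then $Q$ is solvable (resp. nilpotent) of length less than or equal to $n+1$.
   Context: A left quasigroup is a (nonempty) set $Q$ with binary operations $*,\backslash$ such that $x*(x\backslash y)=y=x\backslash(x*y)$; equivalently every $L_x:y\mapsto x*y$ is a bijection, and $x\backslash y=L_x^{-1}(y)$. Congruences are equivalence relations compatible with $*$ and $\backslash$. $\mathrm{LMlt}(Q)=\langle L_a: a\in Q\rangle$, and $\mathrm{Dis}(Q)$ is the normal closure in $\mathrm{LMlt}(Q)$ of $\{L_aL_b^{-1}:a,b\in Q\}$. LT property: an LT term is a term of the form $t(x_1,\ldots,x_n)=s_1(x_{i_1})\bullet_1(s_2(x_{i_2})\bullet_2(\ldots(s_{m-1}(x_{i_{m-1}})\bullet_{m-1}s_m(x_{i_m}))\ldots))$ where each $s_i$ is a unary term in the language $\{*,\backslash\}$ and $\bullet_i\in\{*,\backslash\}$. $Q$ has the LT property if every term is equivalent on $Q$ to an LT term (i.e. the corresponding identity holds in $Q$). For $N\leq\mathrm{LMlt}(Q)$, $\mathcal{O}_N$ is the orbit equivalence relation of $N$ on $Q$ and $\mathrm{con}_N=\{(a,b): L_aL_b^{-1}\in N\}$. $\mathrm{Norm}(Q)=\{N\trianglelefteq \mathrm{LMlt}(Q): \mathcal{O}_N\leq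 \mathrm{con}_N\}$. A series $1=H_0\leq H_1\leq\ldots\leq H_n=G$ of a group $G$ is central (resp. abelian) if each $H_i\trianglelefteq G$ and $H_{i+1}/H_i\leq Z(G/H_i)$ (resp. $H_{i+1}/H_i$ is abelian) for every $i\in\{0,\ldots,n-1\}$. Commutator theory: for congruences $\alpha,\beta,\delta$ of an algebra $A$, $C(\alpha,\beta;\delta)$ means that for every $(k+1)$-ary term operation $t$, every $a\,\alpha\,b$ and all $u_1\,\beta\,v_1,\ldots,u_k\,\beta\,v_k$, $t(a,u_1,\ldots,u_k)\,\delta\,t(a,v_1,\ldots,v_k)$ implies $t(b,u_1,\ldots,u_k)\,\delta\,t(b,v_1,\ldots,v_k)$. A congruence $\alpha$ is abelian if $C(\alpha,\alpha;0_A)$ and central if $C(\alpha,1_A;0_A)$, where $0_A$ is equality and $1_A=A\times A$. $A$ is nilpotent (resp. solvable) if there is a chain of congruences $0_A=\alpha_0\leq\ldots\leq\alpha_m=1_A$ with $\alpha_{i+1}/\alpha_i$ central (resp. abelian) in $A/\alpha_i$ for all $i$; the smallest such $m$ is the length of nilpotence (resp. solvability). *)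

(* Defs.v *)
From HB Require Import structures.
From mathcomp Require Import all_boot.
From mathcomp Require Import boolp classical_sets.

Set Implicit Arguments.
Unset Strict Implicit.
Unset Printing Implicit Defensive.

Local Open Scope classical_set_scope.
Local Open Scope group_scope.
Local Open Scope quotient_scope.

HB.mixin Record isLeftQuasigroup (Q : Type) := {
  lmul : Q -> Q -> Q;
  ldiv : Q -> Q -> Q;
  ldivKl : forall x y, lmul x (ldiv x y) = y;
  lmulKl : forall x y, ldiv x (lmul x y) = y;
  lq_inhabited : inhabited Q
}.

#[short(type="leftQuasigroup")]
HB.structure Definition LeftQuasigroup := {Q of isLeftQuasigroup Q}.

Inductive term (V : Type) : Type :=
| Var of V
| Mul of term V & term V
| Div of term V & term V.

Fixpoint eval (V : Type) (Q : leftQuasigroup) (e : V -> Q) (t : term V) : Q :=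
  match t with
  | Var v => e v
  | Mul s t => lmul (eval e s) (eval e t)
  | Div s t => ldiv (eval e s) (eval e t)
  end.

Fixpoint term_map (V W : Type) (f : V -> W) (t : term V) : term W :=
  match t with
  | Var v => Var (f v)
  | Mul s t => Mul (term_map f s) (term_map f t)
  | Div s t => Div (term_map f s) (term_map f t)
  end.

(* The term s(x_i), for s a unary term. *)
Definition unary_at (n : nat) (s : term 'I_1) (i : 'I_n) : term 'I_n :=
  term_map (fun=> i) s.

Inductive LT_term (n : nat) : term 'I_n -> Prop :=
| LT_last s i : LT_term (unary_at s i)
| LT_mul s i t : LT_term t -> LT_term (Mul (unary_at s i) t)
| LT_div s i t : LT_term t -> LT_term (Div (unary_at s i) t).

Definition identity_holds (Q : leftQuasigroup) (n : nat) (s t : term 'I_n) :=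
  forall e : 'I_n -> Q, eval e s = eval e t.

Definition LT_property (Q : leftQuasigroup) : Prop :=
  forall (n : nat) (t : term 'I_n),
    exists t' : term 'I_n, LT_term t' /\ identity_holds Q t t'.

Record congruence (Q : leftQuasigroup) := Congruence {
  con_rel :> Q -> Q -> Prop;
  con_refl : forall x, con_rel x x;
  con_sym : forall x y, con_rel x y -> con_rel y x;
  con_trans : forall x y z, con_rel x y -> con_rel y z -> con_rel x z;
  con_lmul : forall x x' y y',
    con_rel x x' -> con_rel y y' -> con_rel (lmul x y) (lmul x' y');
  con_ldiv : forall x x' y y',
    con_rel x x' -> con_rel y y' -> con_rel (ldiv x y) (ldiv x' y')
}.

Section Quotient.
Variables (Q : leftQuasigroup) (al : congruence Q).

Definition con_rel_bool : rel {classic Q} := fun x y => `[< al x y >].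

Lemma con_rel_bool_equiv : equiv_class_of con_rel_bool.
Proof.
split=> [x | x y | y x z].
- exact/asboolP/con_refl.
- by apply/asboolP/asboolP; exact: con_sym.
- by move=> /asboolP xy /asboolP yz; exact/asboolP/(con_trans xy yz).
Qed.

Canonical con_equiv_rel := EquivRelPack con_rel_bool_equiv.

Definition quot : Type := {eq_quot con_equiv_rel}.

Definition quot_pi (x : Q) : quot := \pi_({eq_quot con_equiv_rel}) (x : {classic Q}).
Definition quot_repr (X : quot) : Q := repr (X : {eq_quot con_equiv_rel}).

Lemma quot_reprK : cancel quot_repr quot_pi.
Proof. by move=> X; exact: (@reprK _ {eq_quot con_equiv_rel}). Qed.

Lemma quot_piP (x y : Q) : quot_pi x = quot_pi y <-> al x y.
Proof.
split=> [/(@eqmodP _ con_equiv_rel) | xy]; first by move=> /asboolP.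
by apply/(@eqmodP _ con_equiv_rel)/asboolP.
Qed.

Lemma con_repr_pi (x : Q) : al (quot_repr (quot_pi x)) x.
Proof. by apply/quot_piP; rewrite quot_reprK. Qed.

Definition quot_lmul (X Y : quot) : quot :=
  quot_pi (lmul (quot_repr X) (quot_repr Y)).
Definition quot_ldiv (X Y : quot) : quot :=
  quot_pi (ldiv (quot_repr X) (quot_repr Y)).

Lemma quot_piM (x y : Q) :
  quot_pi (lmul x y) = quot_lmul (quot_pi x) (quot_pi y).
Proof. by apply/esym/quot_piP/con_lmul; exact: con_repr_pi. Qed.

Lemma quot_piD (x y : Q) :
  quot_pi (ldiv x y) = quot_ldiv (quot_pi x) (quot_pi y).
Proof. by apply/esym/quot_piP/con_ldiv; exact: con_repr_pi. Qed.

Fact quot_ldivKl X Y : quot_lmul X (quot_ldiv X Y) = Y.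
Proof.
by rewrite -[X]quot_reprK -[Y]quot_reprK -quot_piD -quot_piM ldivKl.
Qed.

Fact quot_lmulKl X Y : quot_ldiv X (quot_lmul X Y) = Y.
Proof.
by rewrite -[X]quot_reprK -[Y]quot_reprK -quot_piM -quot_piD lmulKl.
Qed.

Fact quot_inhabited : inhabited quot.
Proof. by case: (@lq_inhabited Q) => x; exists; exact: quot_pi x. Qed.

HB.instance Definition _ := isLeftQuasigroup.Build quot
  quot_ldivKl quot_lmulKl quot_inhabited.

(* The relation be/al on Q/al. *)
Definition quot_rel (be : Q -> Q -> Prop) (X Y : quot) : Prop :=
  exists x y, [/\ X = quot_pi x, Y = quot_pi y & be x y].

End Quotient.

Arguments quot_rel {Q} al be X Y.

Section Commutator.
Variable A : leftQuasigroup.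

Definition cons_env (k : nat) (a : A) (u : 'I_k -> A) (i : 'I_k.+1) : A :=
  if unlift ord0 i is Some j then u j else a.

Definition centralizes (al be de : A -> A -> Prop) : Prop :=
  forall (k : nat) (t : term 'I_k.+1) (a b : A) (u v : 'I_k -> A),
    al a b -> (forall j, be (u j) (v j)) ->
    de (eval (cons_env a u) t) (eval (cons_env a v) t) ->
    de (eval (cons_env b u) t) (eval (cons_env b v) t).

Definition abelian_con (al : A -> A -> Prop) : Prop :=
  centralizes al al eq.

Definition central_con (al : A -> A -> Prop) : Prop :=
  centralizes al (fun _ _ => True) eq.

End Commutator.

Definition congruence_chain
    (P : forall A : leftQuasigroup, (A -> A -> Prop) -> Prop)
    (Q : leftQuasigroup) (m : nat) : Prop :=
  exists al : nat -> congruence Q,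
    [/\ forall x y, al 0%N x y <-> x = y,
        forall x y, al m x y,
        forall i, (i < m)%N -> forall x y, al i x y -> al i.+1 x y
      & forall i, (i < m)%N -> P (quot (al i)) (quot_rel (al i) (al i.+1))].

Definition smallest_nat (P : nat -> Prop) (m : nat) : Prop :=
  P m /\ forall m', P m' -> (m <= m')%N.

Definition solvable_of_length (Q : leftQuasigroup) : nat -> Prop :=
  smallest_nat (congruence_chain abelian_con Q).

Definition nilpotent_of_length (Q : leftQuasigroup) : nat -> Prop :=
  smallest_nat (congruence_chain central_con Q).

Record Sym (T : Type) := MkSym {
  sym_fun :> T -> T;
  sym_inv : T -> T;
  sym_funK : cancel sym_fun sym_inv;
  sym_invK : cancel sym_inv sym_fun
}.

Section SymGroup.
Variable T : Type.

Lemma sym_ext (f g : Sym T) : f =1 g -> f = g.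
Proof.
case: f g => [f f' fK f'K] [g g' gK g'K] /= /funext fg; subst g.
have E : f' = g' by apply/funext => x; rewrite -[in LHS](g'K x) fK.
by subst g'; congr MkSym; exact: Prop_irrelevance.
Qed.

HB.instance Definition _ := gen_eqMixin (Sym T).
HB.instance Definition _ := gen_choiceMixin (Sym T).

Definition sym_one : Sym T := @MkSym T id id (fun=> erefl) (fun=> erefl).
Definition sym_mul (f g : Sym T) : Sym T :=
  MkSym (can_comp (sym_funK f) (sym_funK g)) (can_comp (sym_invK g) (sym_invK f)).
Definition sym_opp (f : Sym T) : Sym T := MkSym (sym_invK f) (sym_funK f).

Fact sym_mulA : associative sym_mul.
Proof. by move=> f g h; exact: sym_ext. Qed.
Fact sym_mul1 : left_id sym_one sym_mul.
Proof. by move=> f; exact: sym_ext. Qed.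
Fact sym_mulr1 : right_id sym_one sym_mul.
Proof. by move=> f; exact: sym_ext. Qed.
Fact sym_mulV : left_inverse sym_one sym_opp sym_mul.
Proof. by move=> f; apply: sym_ext => x /=; rewrite sym_funK. Qed.
Fact sym_mulrV : right_inverse sym_one sym_opp sym_mul.
Proof. by move=> f; apply: sym_ext => x /=; rewrite sym_invK. Qed.

HB.instance Definition _ := isGroup.Build (Sym T)
  sym_mulA sym_mul1 sym_mulr1 sym_mulV sym_mulrV.

End SymGroup.

Section GroupSets.
Variable G : groupType.
Implicit Types A B H N : set G.

Definition subgroup H : Prop :=
  [/\ H 1, forall x y, H x -> H y -> H (x * y) & forall x, H x -> H x^-1].

Definition normal_in A N : Prop :=
  [/\ subgroup N, N `<=` A & forall g x, A g -> N x -> N (g * x * g^-1)].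

Definition set_prod A B : set G := [set x * y | x in A & y in B].

Definition coset H (x : G) : set G := [set x * h | h in H].

(* A/H as a set of cosets; when H is normal in A, set_prod is its group law. *)
Definition group_quot A H : set (set G) := [set coset H x | x in A].

Definition quot_abelian (X : set (set G)) : Prop :=
  forall C D, X C -> X D -> set_prod C D = set_prod D C.

Definition quot_center (X : set (set G)) : set (set G) :=
  [set C | X C /\ forall D, X D -> set_prod C D = set_prod D C].

Definition normal_series A (n : nat) (H : nat -> set G) : Prop :=
  [/\ H 0%N = [set 1], H n = A,
      forall i, (i < n)%N -> H i `<=` H i.+1
    & forall i, (i <= n)%N -> normal_in A (H i)].

Definition abelian_series A n (H : nat -> set G) : Prop :=
  normal_series A n H /\
  forall i, (i < n)%N -> quot_abelian (group_quot (H i.+1) (H i)).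

Definition central_series A n (H : nat -> set G) : Prop :=
  normal_series A n H /\
  forall i, (i < n)%N ->
    group_quot (H i.+1) (H i) `<=` quot_center (group_quot A (H i)).

End GroupSets.

Section TranslationGroups.
Variable Q : leftQuasigroup.

Definition Lmul (x : Q) : Sym Q := MkSym (@lmulKl Q x) (@ldivKl Q x).

Definition LMlt : set (Sym Q) := smallest (@subgroup (Sym Q)) (range Lmul).

(* The normal closure in LMlt of the set of all L_a L_b^-1. *)
Definition Dis : set (Sym Q) :=
  smallest (normal_in LMlt) [set Lmul a * (Lmul b)^-1 | a in setT & b in setT].

Definition orbit_rel (N : set (Sym Q)) (x y : Q) : Prop :=
  exists2 f : Sym Q, N f & f x = y.

Definition con_of (N : set (Sym Q)) (a b : Q) : Prop :=
  N (Lmul a * (Lmul b)^-1).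

Definition Norm : set (set (Sym Q)) :=
  [set N | normal_in LMlt N /\
           forall x y, orbit_rel N x y -> con_of N x y].

End TranslationGroups.

Arguments LMlt Q : clear implicits.
Arguments Dis Q : clear implicits.
Arguments Norm Q : clear implicits.

(* Main.v *)
Require Import Defs.
From mathcomp Require Import all_boot.
From mathcomp Require Import boolp classical_sets.

(** The congruences are the orbit relations of the [H i], followed by the total
relation.  Let [M] and [D] be normal in LMlt with [[M, D]] contained in [N].
Along an LT term, changing an argument [a] to [b] in the same [M]-orbit acts on
the value, modulo [N]-orbits, as some [g] in [M]: the left factors of the term
are translations, and [g] is conjugated by them on its way out.  If the other
arguments change inside [con_of D], these translations change by factors in
[D], which commute with [g] modulo [N], so the same [g] serves before and after
the change.  This is the term condition.  Modulo the orbits of Dis(Q), all left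
translations agree, so a term depends on its rightmost variable only. *)

Set Implicit Arguments.
Unset Strict Implicit.
Unset Printing Implicit Defensive.

Local Open Scope classical_set_scope.
Local Open Scope group_scope.

(** * Commuting cosets *)

Section GroupSets.
Variable G : groupType.
Implicit Types A N : set G.

(** The element [y * x] lies in both set products, so it equals [x * h * (y * k)] with [h] and [k]
    in [N]; the commutator is then a product of conjugates of [h] and [k]. *)
Lemma coset_comm A N x y :
  normal_in A N -> subgroup A -> A x -> A y ->
  set_prod (coset N x) (coset N y) = set_prod (coset N y) (coset N x) ->
  N (y * x * y^-1 * x^-1).
Proof.
move=> [[N1 NM NV] sNA nN] [_ AM AV] Ax Ay /esym E.
have : set_prod (coset N y) (coset N x) (y * x).
  exists y; first by exists 1; rewrite ?mulg1.
  by exists x => //; exists 1; rewrite ?mulg1.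
rewrite E => -[_ [h Nh <-]] [_ [k Nk <-]] xy.
have -> : y * x * y^-1 * x^-1 =
    (x * h * x^-1) * (x * y * k * (x * y)^-1).
  by rewrite -xy invgM !mulgA !mulgVK.
by apply: NM; apply: nN => //; apply: AM.
Qed.

End GroupSets.

(** * Translations and the displacement group *)

Section Translations.
Variable Q : leftQuasigroup.
Implicit Types (N M D : set (Sym Q)) (f g : Sym Q) (x y : Q).

Lemma symM f g x : (f * g) x = f (g x).
Proof. by []. Qed.

Lemma symVK f x : f^-1 (f x) = x.
Proof. exact: sym_funK. Qed.

Lemma smallest_subgroup (X : set (Sym Q)) : subgroup (smallest (@subgroup _) X).
Proof.
split=> [P [[]]//|x y Xx Xy P|x Xx P] [sP XP]; have [P1 PM PV] := sP.
- by apply: PM; [apply: Xx | apply: Xy].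
- by apply: PV; apply: Xx.
Qed.

Lemma LMlt_subgroup : subgroup (LMlt Q).
Proof. exact: smallest_subgroup. Qed.

Lemma LMlt_Lmul x : LMlt Q (Lmul x).
Proof. by move=> P [_]; apply; exists x. Qed.

Lemma LMlt_LmulV x : LMlt Q (Lmul x)^-1.
Proof. by have [_ _] := LMlt_subgroup; apply; apply: LMlt_Lmul. Qed.

Lemma Dis_con x y : con_of (Dis Q) x y.
Proof. by move=> P [_]; apply; exists x => //; exists y. Qed.

Lemma Dis_normal : normal_in (LMlt Q) (Dis Q).
Proof.
have [L1 LM LV] := LMlt_subgroup.
split; last by move=> g x Lg Dx P [nP XP]; have [_ _] := nP; apply=> //; apply: Dx.
- split=> [P [[[]]]//|x y Dx Dy P|x Dx P] [nP XP]; have [[P1 PM PV] _ _] := nP.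
  + by apply: PM; [apply: Dx | apply: Dy].
  + by apply: PV; apply: Dx.
- apply: smallest_sub => [|_ [a _ [b _ <-]]].
    by split=> // g x Lg Lx; apply: (LM); [apply: LM | apply: LV].
  by apply: LM; [apply: LMlt_Lmul | apply: LMlt_LmulV].
Qed.

Lemma Dis_Norm : Norm Q (Dis Q).
Proof. by split=> [|x y _]; [apply: Dis_normal | apply: Dis_con]. Qed.

Lemma orbit_set1 x y : orbit_rel [set 1] x y <-> x = y.
Proof. by split=> [[_ -> /= <-]|->] //; exists 1. Qed.

Lemma set1_Norm : Norm Q [set 1].
Proof.
have [L1 _ _] := LMlt_subgroup.
split=> [|x y /orbit_set1 ->]; last by rewrite /con_of mulgV.
split=> [|_ ->//|g _ _ ->]; last by rewrite mulg1 mulgV.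
by split=> // [_ _ -> ->|_ ->]; rewrite ?mulg1 ?invg1.
Qed.

(** * Orbit relations as congruences *)

Section OrbitCongruence.
Variable N : set (Sym Q).
Hypothesis NN : Norm Q N.

Lemma orbit_refl x : orbit_rel N x x.
Proof. by have [[[N1 _ _] _ _] _] := NN; exists 1. Qed.

Lemma orbit_sym x y : orbit_rel N x y -> orbit_rel N y x.
Proof.
have [[[_ _ NV] _ _] _] := NN.
by move=> [f Nf <-]; exists f^-1; [apply: NV | rewrite symVK].
Qed.

Lemma orbit_trans x y z :
  orbit_rel N x y -> orbit_rel N y z -> orbit_rel N x z.
Proof.
have [[[_ NM _] _ _] _] := NN.
by move=> [f Nf <-] [g Ng <-]; exists (g * f) => //; apply: NM.
Qed.

Lemma orbit_app f x y :
  LMlt Q f -> orbit_rel N x y -> orbit_rel N (f x) (f y).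
Proof.
have [[_ _ nN] _] := NN; move=> Lf [g Ng <-].
by exists (f * g * f^-1); [apply: nN | rewrite !symM symVK].
Qed.

Lemma con_of_lmul x x' y :
  con_of N x' x -> orbit_rel N (lmul x y) (lmul x' y).
Proof. by move=> Nx; exists (Lmul x' * (Lmul x)^-1); rewrite //= lmulKl. Qed.

(** The element needed is [(Lmul x')^-1 * Lmul x], a conjugate of [Lmul x * (Lmul x')^-1]; this is
    where normality enters. *)
Lemma con_of_ldiv x x' y :
  con_of N x x' -> orbit_rel N (ldiv x y) (ldiv x' y).
Proof.
have [[_ _ nN] _] := NN => Nx.
exists ((Lmul x')^-1 * (Lmul x * (Lmul x')^-1) * Lmul x').
  by rewrite -{2}[Lmul x']invgK; apply: nN => //; apply: LMlt_LmulV.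
by rewrite /= lmulKl ldivKl.
Qed.

(** The left argument moves because orbits lie inside [con_of N], the right one because LMlt
    permutes the orbits of [N]. *)
Lemma orbit_lmul x x' y y' : orbit_rel N x x' -> orbit_rel N y y' ->
  orbit_rel N (lmul x y) (lmul x' y').
Proof.
have [_ cN] := NN; move=> /orbit_sym/cN xx' yy'.
apply: orbit_trans (con_of_lmul y xx') _.
exact: (orbit_app (LMlt_Lmul x') yy').
Qed.

Lemma orbit_ldiv x x' y y' : orbit_rel N x x' -> orbit_rel N y y' ->
  orbit_rel N (ldiv x y) (ldiv x' y').
Proof.
have [_ cN] := NN; move=> /cN xx' yy'.
apply: orbit_trans (con_of_ldiv y xx') _.
exact: (orbit_app (LMlt_LmulV x') yy').
Qed.

Definition orbit_con : congruence Q :=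
  Congruence orbit_refl orbit_sym orbit_trans orbit_lmul orbit_ldiv.

End OrbitCongruence.

Definition total_con : congruence Q :=
  @Congruence Q (fun _ _ => True) (fun=> I) (fun _ _ _ => I)
    (fun _ _ _ _ _ => I) (fun _ _ _ _ _ _ => I) (fun _ _ _ _ _ _ => I).

Lemma eval_con (al : congruence Q) (V : Type) (e e' : V -> Q) (t : term V) :
  (forall v, al (e v) (e' v)) -> al (eval e t) (eval e' t).
Proof.
by move=> ee'; elim: t => //= s IHs t IHt; [apply: con_lmul | apply: con_ldiv].
Qed.

Lemma eval_term_map (V W : Type) (h : V -> W) (e : W -> Q) (t : term V) :
  eval e (term_map h t) = eval (e \o h) t.
Proof. by elim: t => //= s -> t ->. Qed.

Lemma eval_unary_at (n : nat) (e : 'I_n -> Q) s i :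
  eval e (unary_at s i) = eval (fun=> e i) s.
Proof. exact: eval_term_map. Qed.

(** * The term condition along LT terms *)

Section TermCondition.
Variables N M D : set (Sym Q).
Hypotheses (NN : Norm Q N) (NM : Norm Q M) (nD : normal_in (LMlt Q) D).
Hypothesis MDN : forall g d, M g -> D d -> N (d * g * d^-1 * g^-1).
Variable be : congruence Q.
Hypothesis be_con : forall x y, be x y -> con_of D x y.

(* The values at (a,u), (b,u), (a,v), (b,v) of a variable, or of a unary term:
   it depends either on the argument [a], [b] or on the arguments [u], [v]. *)
Definition split_square (p q r s : Q) : Prop :=
  (p = r /\ q = s) /\ orbit_rel M p q \/ (p = q /\ r = s) /\ be p r.

(** Sharing one [g] is the point: if [p] and [r] are in one [N]-orbit, then so are [g p] and [g r],
    hence [q] and [s]. *)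
Definition common_shift (p q r s : Q) : Prop :=
  exists2 g, M g & orbit_rel N q (g p) /\ orbit_rel N s (g r).

Lemma split_square_eval p q r s (t : term 'I_1) :
  split_square p q r s ->
  split_square (eval (fun=> p) t) (eval (fun=> q) t)
               (eval (fun=> r) t) (eval (fun=> s) t).
Proof.
move=> [[[-> ->] h]|[[-> ->] h]]; [left | right]; split=> //.
- exact: (@eval_con (orbit_con NM)).
- exact: eval_con.
Qed.

Lemma split_square_shift p q r s :
  split_square p q r s -> common_shift p q r s.
Proof.
have [[[M1 _ _] _ _] _] := NM.
move=> [[[-> ->] [g Mg <-]]|[[-> ->] _]].
- by exists g => //; split; apply: orbit_refl.
- by exists 1 => //; split; apply: orbit_refl.
Qed.

Lemma common_shift_app fp fq fr fs p q r s :
  LMlt Q fp -> LMlt Q fq ->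
  (fp = fr /\ fq = fs) /\ M (fq * fp^-1) \/
  (fp = fq /\ fr = fs) /\ D (fp^-1 * fr) ->
  common_shift p q r s -> common_shift (fp p) (fq q) (fr r) (fs s).
Proof.
have [[[_ MM _] _ nM] _] := NM; have [[_ _ nN] _] := NN.
have [_ LM _] := LMlt_subgroup; have [_ sDL _] := nD.
move=> Lp Lq [[[<- <-] Mf]|[[<- <-] Df]] [g Mg [qp sr]].
(* The witness is [fq * g * fp^-1], written so that membership in [M] is visible. *)
- exists (fq * g * fq^-1 * (fq * fp^-1)); first by apply: MM => //; apply: nM.
  by rewrite !symM !symVK; split; apply: orbit_app.
- exists (fp * g * fp^-1); first exact: nM.
  rewrite !symM !symVK; split; first exact: orbit_app.
  have Lr : LMlt Q fr by rewrite -[fr](mulVKg fp); apply: LM => //; apply: sDL.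
  apply: (orbit_trans NN (orbit_app NN Lr sr)); apply: orbit_sym => //.
  (* With [d = fp^-1 * fr], this is the commutator of [d] and [g] conjugated by [fp]; it carries
     [(fp * g * fp^-1) (fr r)] to [fr (g r)]. *)
  exists (fp * (fp^-1 * fr * g * (fp^-1 * fr)^-1 * g^-1) * fp^-1).
    by apply: nN => //; apply: MDN.
  rewrite -[LHS]/((fp * (fp^-1 * fr * g * (fp^-1 * fr)^-1 * g^-1) * fp^-1 *
    (fp * g * fp^-1 * fr)) r) -[RHS]/((fr * g) r).
  by congr (sym_fun _ r); rewrite invgM invgK !mulgA !(mulgVK, mulgK) mulgV mul1g.
Qed.

(** Each left factor of an LT term contains a single variable, so its four values again form a split
    square and [common_shift_app] applies; an arbitrary left subterm could change in both directions
    at once. *)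
Lemma LT_common_shift n (t : term 'I_n) (e1 e2 e3 e4 : 'I_n -> Q) :
  LT_term t -> (forall i, split_square (e1 i) (e2 i) (e3 i) (e4 i)) ->
  common_shift (eval e1 t) (eval e2 t) (eval e3 t) (eval e4 t).
Proof.
have [[_ _ nM] cM] := NM; have [_ _ cD] := nD.
move=> LTt sq; elim: LTt => [s i|s i {}t _ IH|s i {}t _ IH] /=;
  rewrite !eval_unary_at; have sqs := split_square_eval s (sq i).
- exact: split_square_shift.
- apply: (common_shift_app _ _ _ IH (fp := Lmul _) (fq := Lmul _)
    (fr := Lmul _) (fs := Lmul _)); try exact: LMlt_Lmul.
  case: sqs => [[[<- <-] h]|[[<- <-] h]]; [left | right]; split=> //.
    by apply: cM; apply: orbit_sym.
  (* Conjugation by the inverse translation turns $L_rL_p^{-1}$ into $L_p^{-1}L_r$. For division it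
     is the condition on [M] that needs such a conjugation. *)
  have := cD _ _ (LMlt_LmulV (eval (fun=> e1 i) s)) (be_con (con_sym h)).
  by rewrite invgK !mulgA mulgVK.
- apply: (common_shift_app _ _ _ IH (fp := (Lmul _)^-1) (fq := (Lmul _)^-1)
    (fr := (Lmul _)^-1) (fs := (Lmul _)^-1)); try exact: LMlt_LmulV.
  case: sqs => [[[<- <-] h]|[[<- <-] h]]; [left | right]; split=> //.
    have := nM _ _ (LMlt_LmulV (eval (fun=> e2 i) s)) (cM _ _ h).
    by rewrite !invgK !mulgA mulgVK.
  by rewrite invgK; apply: be_con.
Qed.

(** The abelian case takes [D = M] with [be] the [M]-orbit relation; the central case takes
    [D = Dis Q] with [be] total. *)
Lemma LT_centralizes :
  LT_property Q -> centralizes (orbit_rel M) be (orbit_rel N).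
Proof.
move=> LTQ k t a b u v ab uv.
have [t' [LTt' tt']] := LTQ _ t; rewrite !tt' => tauv.
have sq i : split_square (cons_env a u i) (cons_env b u i)
                         (cons_env a v i) (cons_env b v i).
  by rewrite /cons_env; case: unliftP => [j|] _; [right | left].
have [g Mg [bu bv]] := LT_common_shift LTt' sq.
have [[_ sML _] _] := NM.
apply: (orbit_trans NN bu); apply: (orbit_trans NN _ (orbit_sym NN bv)).
by apply: orbit_app => //; apply: sML.
Qed.

End TermCondition.

(** * Terms modulo the orbits of Dis(Q) *)

Lemma eval_Dis_rightmost n (t : term 'I_n) :
  exists i, exists2 f, LMlt Q f &
    forall e : 'I_n -> Q, orbit_rel (Dis Q) (eval e t) (f (e i)).
Proof.
(* Replacing every left factor by one fixed [q0] makes [f] independent of [e]. *)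
have [L1 LM _] := LMlt_subgroup; have [q0] := @lq_inhabited Q.
elim: t => [i|s _ t [i [f Lf ft]]|s _ t [i [f Lf ft]]] /=.
- by exists i, 1 => // e; apply: orbit_refl; apply: Dis_Norm.
- exists i, (Lmul q0 * f) => [|e]; first by apply: LM => //; apply: LMlt_Lmul.
  apply: (orbit_trans Dis_Norm (con_of_lmul _ (Dis_con q0 _))).
  exact: (orbit_app Dis_Norm (LMlt_Lmul q0) (ft e)).
- exists i, ((Lmul q0)^-1 * f) => [|e].
    by apply: LM => //; apply: LMlt_LmulV.
  apply: (orbit_trans Dis_Norm (con_of_ldiv Dis_Norm _ (Dis_con _ q0))).
  exact: (orbit_app Dis_Norm (LMlt_LmulV q0) (ft e)).
Qed.

(** This handles the top step of the chain, from the Dis(Q)-orbits to the total relation, which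
    accounts for the extra 1 in the length. *)
Lemma Dis_centralizes (al be : Q -> Q -> Prop) :
  centralizes al be (orbit_rel (Dis Q)).
Proof.
move=> k t a b u v _ _ tauv; have [i [f _ tf]] := eval_Dis_rightmost t.
have trD := orbit_trans Dis_Norm; have symD := orbit_sym Dis_Norm.
apply: (trD _ _ _ (tf _)); apply: (trD _ _ _ _ (symD _ _ (tf _))).
have := trD _ _ _ (symD _ _ (tf _)) (trD _ _ _ tauv (tf _)).
(* If the rightmost variable is the distinguished one, both sides are [f b]; otherwise neither [a]
   nor [b] occurs and the assumption is the claim. *)
rewrite /cons_env; case: unliftP => // _ _; exact: (orbit_refl Dis_Norm).
Qed.

(** * Descent to quotients *)

Lemma eval_quot_pi (de : congruence Q) (V : Type) (e : V -> Q) (t : term V) :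
  eval (quot_pi de \o e) t = quot_pi de (eval e t).
Proof. by elim: t => //= s -> t ->; rewrite ?quot_piM ?quot_piD. Qed.

(** Related classes lift to related representatives. The separate [be'] allows the total relation on
    the quotient, as [central_con] requires. *)
Lemma quot_centralizes (al be : Q -> Q -> Prop) (de : congruence Q)
    (be' : quot de -> quot de -> Prop) :
  (forall X Y, be' X Y -> quot_rel de be X Y) ->
  centralizes al be de -> centralizes (quot_rel de al) be' eq.
Proof.
move=> sbe C k t _ _ U V [x [y [-> -> xy]]] UV.
have /choice[w /all_and3[Uw Vw w12]] : forall j, exists w : Q * Q,
    [/\ U j = quot_pi de w.1, V j = quot_pi de w.2 & be w.1 w.2].
  by move=> j; have [a [b ?]] := sbe _ _ (UV j); exists (a, b).
have consE z (Z : 'I_k -> quot de) (h : 'I_k -> Q) :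
    (forall j, Z j = quot_pi de (h j)) ->
    cons_env (quot_pi de z) Z = quot_pi de \o cons_env z h.
  by move=> Zh; apply/funext => i; rewrite /cons_env /=; case: unlift.
rewrite !(consE _ _ _ Uw) !(consE _ _ _ Vw) !eval_quot_pi => /quot_piP xUV.
by apply/quot_piP; apply: C xy _ xUV.
Qed.

End Translations.

(** * From group series to chains of congruences *)

Lemma normal_series_sub (G : groupType) (A : set G) n H :
  normal_series A n H -> forall i, (i <= n)%N -> H i `<=` A.
Proof. by move=> [_ _ _ nH] i /nH[]. Qed.

Lemma congruence_chain_smallest
    (P : forall A : leftQuasigroup, (A -> A -> Prop) -> Prop) Q n :
  congruence_chain P Q n ->
  exists2 m, smallest_nat (congruence_chain P Q) m & (m <= n)%N.
Proof.
move=> Pn; have ex : exists m, `[< congruence_chain P Q m >].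
  by exists n; apply/asboolP.
case: (ex_minnP ex) => m /asboolP Pm min_m.
exists m; last by apply: min_m; apply/asboolP.
by split=> // k Pk; apply: min_m; apply/asboolP.
Qed.

Section NormSeries.
Variables (Q : leftQuasigroup) (n : nat) (H : nat -> set (Sym Q)).
Hypothesis NH : forall i, (1 <= i <= n.-1)%N -> Norm Q (H i).
Hypothesis sH : normal_series (Dis Q) n H.

(** Only the inner terms are covered by [NH]; the endpoints are the trivial group and Dis(Q). *)
Lemma series_Norm i : (i <= n)%N -> Norm Q (H i).
Proof.
have [H0 Hn _ _] := sH; case: i => [|i] lein; first by rewrite H0; apply: set1_Norm.
have [->|neq] := eqVneq i.+1 n; first by rewrite Hn; apply: Dis_Norm.
by apply: NH; move: lein; rewrite leq_eqVlt (negPf neq); case: (n).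
Qed.

Lemma orbit_congruence_chain
    (P : forall A : leftQuasigroup, (A -> A -> Prop) -> Prop) :
  (forall i (de al : congruence Q), (i < n)%N ->
     con_rel de = orbit_rel (H i) -> con_rel al = orbit_rel (H i.+1) ->
     P (quot de) (quot_rel de al)) ->
  (forall de al : congruence Q, con_rel de = orbit_rel (Dis Q) ->
     P (quot de) (quot_rel de al)) ->
  congruence_chain P Q n.+1.
Proof.
have [H0 Hn Hle _] := sH; move=> Pi Pn.
(* Building [orbit_con] needs a proof of [i <= n], so the family is chosen through an equation of
   relations; beyond [n] it is total. *)
have /choice[al alE] : forall i, exists al : congruence Q,
    con_rel al = if (i <= n)%N then orbit_rel (H i) else fun _ _ => True.
  move=> i; case: (leqP i n) => [lein|_]; last by exists (total_con Q).
  by exists (orbit_con (series_Norm lein)).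
exists al; split=> [x y|x y|i|i].
- by rewrite alE leq0n H0; apply: orbit_set1.
- by rewrite alE ltnn.
- rewrite ltnS => lein x y; rewrite !alE lein; case: ifP => // ltin [f Hf <-].
  by exists f => //; apply: Hle.
- rewrite ltnS leq_eqVlt => /orP[/eqP->|ltin].
    by apply: Pn; rewrite alE leqnn Hn.
  by apply: (Pi i) => //; rewrite alE ?ltin // ltnW.
Qed.

End NormSeries.

Theorem proposition2p6 (Q : leftQuasigroup) (n : nat) (H : nat -> set (Sym Q)) :
  LT_property Q ->
  (forall i, (1 <= i <= n.-1)%N -> Norm Q (H i)) ->
  (abelian_series (Dis Q) n H ->
     exists2 m, solvable_of_length Q m & (m <= n.+1)%N) /\
  (central_series (Dis Q) n H ->
     exists2 m, nilpotent_of_length Q m & (m <= n.+1)%N).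
Proof.
move=> LTQ NH; have [sD _ _] := Dis_normal Q.
split=> -[sH cH]; apply: congruence_chain_smallest;
  apply: (orbit_congruence_chain NH sH) => [i de al ltin deE alE|de al deE].
- have Hsub := normal_series_sub sH ltin; have [_ _ _ nH] := sH.
  have NM := series_Norm NH sH ltin; have [nM cM] := NM.
  apply: (quot_centralizes (be := al)) => //; rewrite deE {1}alE.
  apply: (LT_centralizes (series_Norm NH sH (ltnW ltin)) NM nM) => // [g d Mg Md|x y].
    (* Commuting cosets in [H i.+1] modulo [H i] put the commutators of [H i.+1] into [H i]. *)
    apply: (coset_comm (nH _ (ltnW ltin)) sD (Hsub _ Mg) (Hsub _ Md)).
    by apply: (cH i ltin); [exists g | exists d].
  by rewrite alE; apply: cM.
- by apply: (quot_centralizes (be := al)) => //; rewrite deE; apply: Dis_centralizes.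
- have Hsub := normal_series_sub sH ltin; have [_ _ _ nH] := sH.
  have NM := series_Norm NH sH ltin.
  apply: (quot_centralizes (be := total_con Q)) => [X Y _|].
    by exists (quot_repr X), (quot_repr Y); rewrite !quot_reprK.
  rewrite deE alE.
  apply: (LT_centralizes (series_Norm NH sH (ltnW ltin)) NM (Dis_normal Q)) => //
    [g d Mg Dd|x y _]; last exact: Dis_con.
  (* Here [d] ranges over all of Dis(Q), since the coset of [g] is central modulo [H i]. *)
  apply: (coset_comm (nH _ (ltnW ltin)) sD (Hsub _ Mg) Dd).
  have [|_] := cH i ltin (coset (H i) g); first by exists g.
  by apply; exists d.
- apply: (quot_centralizes (be := total_con Q)) => [X Y _|].
    by exists (quot_repr X), (quot_repr Y); rewrite !quot_reprK.
  by rewrite deE; apply: Dis_centralizes.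
Qed.
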